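(* Let $\mathcal{D}$ be a dyadic grid on $\mathbb{R}$. Then $H^{1/2}_{\mathcal{D}}(\mathbb{R})\subseteq \mathrm{BMO}_{\mathcal{D}}(\mathbb{R})$.
   Context: A dyadic grid $\mathcal{D}$ on $\mathbb{R}$ is a collection of intervals such that: (D1) every $I\in\mathcal{D}$ has length $2^k$ for some $k\in\mathbb{Z}$; (D2) for any fixed $k_0\in\mathbb{Z}$, the intervals of $\mathcal{D}$ of length $2^{k_0}$ form a partition of $\mathbb{R}$; (D3) $I\cap J\in\{\varnothing,I,J\}$ for all $I,J\in\mathcal{D}$. $|\cdot|$ denotes Lebesgue measure. For $I\in\mathcal{D}$, $I_+$ and $I_-$ denote the right and left halves of $I$ (the two elements of $\mathcal{D}$ of length $|I|/2$ contained in $I$), and $h_I:=|I|^{-1/2}(\mathbf{1}_{I_+}-\mathbf{1}_{I_-})$ is the Haar function; $\{h_I\}_{I\in\mathcal{D}}$ is an orthonormal basis of $L^2(\mathbb{R})$. Functions are real-valued, $(f,g):=\int_{\mathbb{R}}fg\,dx$ and $\langle f\rangle_I:=\frac1{|I|}\int_I f\,dx$. $H^{1/2}_{\mathcal{D}}(\mathbb{R})$ is the space of $f\in L^2(\mathbb{R})$ with $\sum_{I\in\mathcal{D}}|I|^{-1}|(f,h_I)|^2<\infty$. $\mathrm{BMO}_{\mathcal{D}}(\mathbb{R})$ is the dyadic space of functions of bounded mean oscillation: locally integrable $f$ with $\|f\|_{\mathrm{BMO}_{\mathcal{D}}}:=\sup_{I\in\mathcal{D}}\frac1{|I|}\int_I|f-\langle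 f\rangle_I|\,dx<\infty$; the known characterization of this norm is $$\|f\|_{\mathrm{BMO}_{\mathcal{D}}}\simeq\sup_{I\in\mathcal{D}}\Big(\frac1{|I|}\sum_{J\in\mathcal{D},\,J\subseteq I}(f,h_J)^2\Big)^{1/2},$$ where $\simeq$ means bounded above and below up to absolute positive constants. *)

(* Defs.v *)
From HB Require Import structures.
From mathcomp Require Import all_boot all_order all_algebra.
From mathcomp Require Import all_classical all_reals all_analysis.

Set Implicit Arguments.
Unset Strict Implicit.
Unset Printing Implicit Defensive.

Import Order.TTheory GRing.Theory Num.Theory.
Import numFieldNormedType.Exports.

Local Open Scope classical_set_scope.
Local Open Scope ring_scope.

Section dyadic.
Context {R : realType}.
Implicit Types (D : set (set R)) (I J : set R) (f g : R -> R).

Local Notation mu := (@lebesgue_measure R).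

Definition len I : R := fine (mu I).

(* No convention is imposed on the endpoints of the intervals: they may be
   open or closed independently, as long as the axioms hold. *)
Record dyadic_grid D : Prop := DyadicGrid {
  dyadic_interval : forall I, D I -> is_interval I;
  dyadic_length : forall I, D I -> exists k : int, mu I = (2 ^ k)%:E;
  dyadic_partition : forall k : int,
    partition [set I | D I /\ mu I = (2 ^ k)%:E] id [set: R];
  dyadic_nested : forall I J, D I -> D J ->
    [\/ I `&` J = set0, I `&` J = I | I `&` J = J] }.

Definition dyadic_children D I : set (set R) :=
  [set J | [/\ D J, J `<=` I & len J = len I / 2]].

(* In a dyadic grid, an interval has exactly two children, and exactly one of
   them shares its right (resp. left) endpoint, so that the default value set0
   is never used. *)
Definition right_half D I : set R :=
  xget set0 [set J | dyadic_children D I J /\ sup J = sup I].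

Definition left_half D I : set R :=
  xget set0 [set J | dyadic_children D I J /\ inf J = inf I].

Definition haar D I : R -> R := fun x =>
  (Num.sqrt (len I))^-1 * (\1_(right_half D I) x - \1_(left_half D I) x).

Definition inner f g : R := \int[mu]_x (f x * g x).

Definition mean f I : R := (len I)^-1 * \int[mu]_(x in I) f x.

(* The two spaces are sets of functions rather than of classes modulo
   almost-everywhere equality; both are closed under a.e. modification by
   measurable functions. *)
Definition H12 D : set (R -> R) :=
  [set f | f \in Lfun mu 2%:E /\
    (\esum_(I in D) ((len I)^-1 * `|inner f (haar D I)| ^+ 2)%:E < +oo)%E].

Definition bmo_norm D f : \bar R :=
  ereal_sup [set ((len I)^-1)%:E * \int[mu]_(x in I) `|f x - mean f I|%:E
            | I in D]%E.

Definition BMO D : set (R -> R) :=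
  [set f | locally_integrable [set: R] f /\ (bmo_norm D f < +oo)%E].

End dyadic.

(* Main.v *)
Require Import Defs.
From mathcomp Require Import all_boot all_order all_algebra.
From mathcomp Require Import all_classical all_reals all_analysis.
From mathcomp Require Import measurable_realfun ring lra.

(** Write c_J for the energy |J|^-1 (f, h_J)^2 of a dyadic interval J, and S for
the sum of all c_J, finite by hypothesis. The Haar coefficients control the L^1
mean oscillation directly, by a recursion over dyadic halves.

Let A(K) be the integral of |f - <f>_K| over K. Passing from K to its halves,
where the mean changes by t / |K| with t the difference of the integrals of f
over the two halves, costs at most
  A(K) <= A(K_-) + A(K_+) + |t|             [oscillation_halves]
and |t| is exactly |K| c_K^(1/2)            [haar_energyE].
Summed naively over all descendants of a fixed I, the errors |J| c_J^(1/2) are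
controlled by Cauchy-Schwarz: the sum of |J|^2 over all dyadic J in I is
2 |I|^2, because the 2^n intervals of generation n contribute 2^-n |I|^2, and
the c_J sum to at most S. This is where the H^(1/2) weight |J|^-1 enters: under
an L^2 hypothesis alone the same sum could diverge. To make an induction out
of it, Cauchy-Schwarz is replaced by
  |t| <= |K|^2 / (2 |I|) + |I| c_K / 2      [ler_weighted_amgm]
whose first term is what |K|^2 / |I| loses when K is cut into its two halves.

The recursion stops at intervals so small that a continuous g, close to f in
L^1(I), varies by at most 1 on them: there A(K) is at most
2 (int_K |f - g| + |K|)                     [oscillation_small].
This bound is additive over halves, so by induction on the scale every dyadic K
in I satisfies
  A(K) <= 2 (int_K |f - g| + |K|) + |K|^2 / |I|
          + (|I| / 2) sum_(J in K) c_J      [oscillation_le_local_energy].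
With K = I and int_I |f - g| <= |I| this gives A(I) / |I| <= 5 + S / 2,
uniformly in I. Local integrability is immediate from |f| <= 1 + f^2. *)

Set Implicit Arguments.
Unset Strict Implicit.
Unset Printing Implicit Defensive.

Import Order.TTheory GRing.Theory Num.Theory.
Import numFieldNormedType.Exports.

Local Open Scope classical_set_scope.
Local Open Scope ring_scope.

(** Lebesgue measure is a measure on [measurableTypeR R], whose display differs
from that of the Borel structure carried by [R] itself, although the
sigma-algebras agree; the display of the measure is the one chosen here. *)
Local Notation borel K := (measurable (K : set (measurableTypeR _))).

(** * Intervals and their length *)

Section interval_sets.
Context {R : realType}.
Implicit Types (A B K : set R).
Local Notation mu := (@lebesgue_measure R).

Lemma le_len A B : borel A -> borel B -> (mu B < +oo)%E ->
  A `<=` B -> len A <= len B.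
Proof.
move=> mA mB Bfin AB.
have AB' : (mu A <= mu B)%E by apply: le_measure => //; rewrite inE.
rewrite /len fine_le// ge0_fin_numE//; exact: le_lt_trans Bfin.
Qed.

(** Both points of the interval span a segment inside it. This is what turns the
measure of an interval of the grid into a bound on its diameter, and shows that
it is bounded. *)
Lemma interval_dist_le_len K x y : is_interval K -> (mu K < +oo)%E ->
  K x -> K y -> y - x <= len K.
Proof.
move=> iK Kfin Kx Ky; have [xy|yx] := ltP x y; last first.
  by rewrite (@le_trans _ _ 0) ?subr_le0// fine_ge0.
have -> : y - x = len `[x, y].
  by rewrite /len lebesgue_measure_itv/= lte_fin xy.
apply: le_len => //; first exact: is_interval_measurable.
by move=> z; rewrite /= in_itv; exact: iK.
Qed.

Lemma disjoint_intervals_lt A B a b : is_interval A -> is_interval B ->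
  A `&` B = set0 -> A a -> B b -> a < b ->
  forall x y, A x -> B y -> x < y.
Proof.
move=> iA iB AB0 Aa Bb ab x y Ax By; rewrite ltNge; apply/negP => yx.
have dis z : A z -> B z -> False.
  by move=> Az Bz; suff : (A `&` B) z by rewrite AB0.
have [ay|ya] := leP a y.
  by apply: (dis y) => //; apply: (iA a x) => //; rewrite ay yx.
by apply: (dis a) => //; apply: (iB y b) => //; rewrite (ltW ya) (ltW ab).
Qed.

Lemma exists_pair_lt K : (0 < mu K)%E -> exists u v, [/\ K u, K v & u < v].
Proof.
move=> K0; apply: contrapT => noP.
have [K00|/set0P[u Ku]] := eqVneq K set0.
  by rewrite K00 measure0 ltxx in K0.
suff Ku1 : K = [set u] by rewrite Ku1 lebesgue_measure_set1 ltxx in K0.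
apply/seteqP; split => [v Kv|_ ->//].
by case: (ltgtP u v) => // uv; case: noP; [exists u, v|exists v, u].
Qed.

End interval_sets.

(** * The two halves of a dyadic interval *)

Section grid.
Context {R : realType}.
Variable D : set (set R).
Hypothesis hD : dyadic_grid D.
Implicit Types (I J K : set R).
Local Notation mu := (@lebesgue_measure R).

Lemma dyadic_len K : D K -> exists k : int, len K = 2 ^ k.
Proof. by case/(dyadic_length hD) => k muK; exists k; rewrite /len muK. Qed.

Lemma dyadic_len_gt0 K : D K -> 0 < len K.
Proof. by case/dyadic_len => k ->; rewrite exprz_gt0. Qed.

Lemma dyadic_mu K : D K -> mu K = (len K)%:E.
Proof. by case/(dyadic_length hD) => k muK; rewrite /len muK. Qed.

Lemma dyadic_mu_lty K : D K -> (mu K < +oo)%E.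
Proof. by move/dyadic_mu => ->; rewrite ltry. Qed.

Lemma dyadic_measurable K : D K -> borel K.
Proof. by move/(dyadic_interval hD)/is_interval_measurable. Qed.

Lemma dyadic_neq0 K : D K -> K !=set0.
Proof.
move=> DK; apply/set0P/eqP => K0; have := dyadic_len_gt0 DK.
by rewrite /len K0 measure0 ltxx.
Qed.

Lemma dyadic_subset_len J K : D J -> D K -> J `<=` K -> len J <= len K.
Proof.
move=> DJ DK; apply: le_len; try exact: dyadic_measurable.
exact: dyadic_mu_lty.
Qed.

(** The generation of half the length covers the line, and its member J through
x is nested with K; it cannot contain K because it is too short. *)
Lemma dyadic_child_at K x :
  D K -> K x -> exists2 J, dyadic_children D K J & J x.
Proof.
move=> DK Kx; have [k muK] := dyadic_length hD DK.
have [cov _ _] := dyadic_partition hD (k - 1).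
have : [set: R] x by [].
rewrite -cov => -[J [DJ muJ] Jx]; exists J => //.
have lJ : len J = len K / 2.
  by rewrite /len muJ muK/= expfzDr// exprN1.
split => //; case: (dyadic_nested hD DK DJ) => [KJ0|KJ|<-]; last 2 first.
- have := dyadic_subset_len DK DJ; rewrite -KJ => /(_ (@subIsetr _ _ _)).
  by rewrite KJ lJ; have := dyadic_len_gt0 DK; lra.
- exact: subIsetl.
- by suff : (K `&` J) x by rewrite KJ0.
Qed.

Lemma dyadic_children_eq K J1 J2 x : D K ->
  dyadic_children D K J1 -> dyadic_children D K J2 -> J1 x -> J2 x -> J1 = J2.
Proof.
move=> DK [DJ1 _ l1] [DJ2 _ l2] J1x J2x.
have [k muJ1] := dyadic_length hD DJ1.
have [_ + _] := dyadic_partition hD k; apply => //=; last by exists x.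
by split=> //; rewrite -muJ1 !dyadic_mu// l1 l2.
Qed.

(** A count by measure: each child has half the measure of K, so one child does
not exhaust K and three disjoint ones do not fit. Being disjoint intervals, the
two children are then ordered on the line. *)
Lemma dyadic_two_children K : D K -> exists J1 J2,
  [/\ dyadic_children D K J1, dyadic_children D K J2,
      J1 `&` J2 = set0, J1 `|` J2 = K & forall x y, J1 x -> J2 y -> x < y].
Proof.
move=> DK; have K0 := dyadic_len_gt0 DK.
have meas J : dyadic_children D K J -> borel J.
  by case=> DJ _ _; exact: dyadic_measurable.
have dis J J' : dyadic_children D K J -> dyadic_children D K J' -> J <> J' ->
    J `&` J' = set0.
  move=> cJ cJ' JJ'; rewrite -subset0 => z [Jz J'z]; apply: JJ'.
  exact: (dyadic_children_eq DK cJ cJ' Jz J'z).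
have muc J : dyadic_children D K J -> mu J = (len K / 2)%:E.
  by case=> DJ _ <-; rewrite dyadic_mu.
have mu2 J J' : dyadic_children D K J -> dyadic_children D K J' -> J <> J' ->
    mu (J `|` J') = (len K)%:E.
  move=> cJ cJ' JJ'.
  have -> : mu (J `|` J') = (mu J + mu J')%E.
    by apply: measureU; [exact: meas|exact: meas|exact: dis].
  by rewrite !muc// -EFinD; congr (_%:E); lra.
have [x Kx] := dyadic_neq0 DK.
have [A cA Ax] := dyadic_child_at DK Kx.
have [B cB AB] : exists2 B, dyadic_children D K B & A <> B.
  apply: contrapT => noB; suff KA : K = A.
    by have := muc _ cA; rewrite -KA dyadic_mu// => -[]; lra.
  apply/seteqP; split=> [y Ky|]; last by case: cA.
  have [B cB By] := dyadic_child_at DK Ky.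
  by have [->//|/eqP BA] := eqVneq A B; case: noB; exists B.
have ABK : A `|` B = K.
  apply/seteqP; split=> [y|y Ky].
    by move=> [Ay|By]; [case: cA => _ + _|case: cB => _ + _]; apply.
  have [C cC Cy] := dyadic_child_at DK Ky.
  have [<-|/eqP AC] := eqVneq C A; first by left.
  have [<-|/eqP BC] := eqVneq C B; first by right.
  have : (mu ((A `|` B) `|` C) <= mu K)%E.
    apply: le_measure; rewrite ?inE.
    - by apply: measurableU; [apply: measurableU|]; exact: meas.
    - exact: dyadic_measurable.
    - by move=> z [[]|]; [case: cA|case: cB|case: cC] => _ + _; apply.
  have -> : mu ((A `|` B) `|` C) = (mu (A `|` B) + mu C)%E.
    apply: measureU; first by apply: measurableU; exact: meas.
    - exact: meas.
    - by rewrite setIUl !dis ?setU0//; exact: nesym.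
  by rewrite mu2// muc// dyadic_mu// lee_fin; lra.
have A0B0 := dis _ _ cA cB AB.
have [DA _ _] := cA; have [DB _ _] := cB.
have iA := dyadic_interval hD DA; have iB := dyadic_interval hD DB.
have [b Bb] := dyadic_neq0 DB.
have [xb|bx|xb] := ltgtP x b.
- by exists A, B; split => //; exact: disjoint_intervals_lt Ax Bb xb.
- exists B, A; split => //; [by rewrite setIC|by rewrite setUC|].
  by apply: disjoint_intervals_lt Bb Ax bx => //; rewrite setIC.
- have : (A `&` B) x by split => //; rewrite xb.
  by rewrite A0B0.
Qed.

Lemma dyadic_has_sup K : D K -> has_sup K.
Proof.
move=> DK; have [x Kx] := dyadic_neq0 DK; split; first by exists x.
exists (x + len K) => y Ky; rewrite -lerBlDl.
apply: interval_dist_le_len => //; last exact: dyadic_mu_lty.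
exact: (dyadic_interval hD).
Qed.

Lemma dyadic_has_inf K : D K -> has_inf K.
Proof.
move=> DK; have [x Kx] := dyadic_neq0 DK; split; first by exists x.
exists (x - len K) => y Ky; rewrite lerBlDr -lerBlDl.
apply: interval_dist_le_len => //; last exact: dyadic_mu_lty.
exact: (dyadic_interval hD).
Qed.

(** Of the two children, only the one on the right has the supremum of K: the
supremum of the other is at most every point of the right child, which has two
distinct points since its measure is positive. Symmetrically for infima, so the
choices in [left_half] and [right_half] are determined. *)
Lemma dyadic_halves K : D K ->
  [/\ dyadic_children D K (left_half D K), dyadic_children D K (right_half D K),
      left_half D K `&` right_half D K = set0
    & left_half D K `|` right_half D K = K].
Proof.
move=> DK; have [A [B [cA cB AB0 ABK ltAB]]] := dyadic_two_children DK.
have [DA _ _] := cA; have [DB _ _] := cB.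
have leAB a b : A a -> B b -> a <= b by move=> Aa /(ltAB _ _ Aa)/ltW.
have supK : sup B = sup K.
  by rewrite -ABK sup_setU//; exact: dyadic_has_sup.
have infK : inf A = inf K.
  by rewrite -ABK inf_setU//; exact: dyadic_has_inf.
have AorB J : dyadic_children D K J -> J = A \/ J = B.
  move=> cJ; have [DJ JK _] := cJ; have [x Jx] := dyadic_neq0 DJ.
  move: (JK _ Jx); rewrite -ABK => -[Ax|Bx]; [left|right].
    exact: (dyadic_children_eq DK cJ cA Jx).
  exact: (dyadic_children_eq DK cJ cB Jx).
have rB : right_half D K = B.
  apply: xget_unique => // J [/AorB[->|//] supA].
  have [|u [v [Bu Bv uv]]] := @exists_pair_lt _ B.
    by rewrite dyadic_mu// lte_fin dyadic_len_gt0.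
  have Au' : sup A <= u.
    by apply: ge_sup; [exact: dyadic_neq0|move=> a /leAB; exact].
  have vB : v <= sup B by apply: ub_le_sup => //; case: (dyadic_has_sup DB).
  have := lt_le_trans uv vB.
  by rewrite supK -supA ltNge Au'.
have lA : left_half D K = A.
  apply: xget_unique => // J [/AorB[//|->] infB].
  have [|u [v [Au Av uv]]] := @exists_pair_lt _ A.
    by rewrite dyadic_mu// lte_fin dyadic_len_gt0.
  have vB : v <= inf B.
    by apply: lb_le_inf; [exact: dyadic_neq0|move=> b; exact: leAB].
  have Au' : inf A <= u by apply: ge_inf => //; case: (dyadic_has_inf DA).
  have := le_lt_trans Au' uv.
  by rewrite infK -infB ltNge vB.
by rewrite lA rB.
Qed.

End grid.

(** * Mean oscillation and Haar coefficients *)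

Section oscillation.
Context {R : realType}.
Implicit Types (A B K : set R) (f g : R -> R) (c : R).
Local Notation mu := (@lebesgue_measure R).

Definition oscillation f K : R := \int[mu]_(x in K) `|f x - mean f K|.

Lemma integrable_cst_finite K c : borel K -> (mu K < +oo)%E ->
  mu.-integrable K (EFin \o (fun=> c)).
Proof.
move=> mK Kfin; apply/integrableP; split; first exact: measurable_cst.
under eq_integral do rewrite /=.
by rewrite integral_cst// lte_mul_pinfty// ltry.
Qed.

Lemma integrable_dist K f g : borel K ->
  mu.-integrable K (EFin \o f) -> mu.-integrable K (EFin \o g) ->
  mu.-integrable K (EFin \o (fun x => `|f x - g x|)).
Proof.
move=> mK fi gi.
have fgi : mu.-integrable K (EFin \o (fun x => f x - g x)).
  exact: (integrableB mK fi gi).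
exact: (integrable_norm fgi).
Qed.

Lemma Rintegral_cst_len K c : borel K -> \int[mu]_(x in K) c = c * len K.
Proof. by move=> mK; rewrite Rintegral_cst. Qed.

Lemma Rintegral_le_dist K f c d : borel K -> (mu K < +oo)%E ->
  mu.-integrable K (EFin \o f) ->
  \int[mu]_(x in K) `|f x - c| <=
  \int[mu]_(x in K) `|f x - d| + `|d - c| * len K.
Proof.
move=> mK Kfin fi.
have ic e := @integrable_cst_finite K e mK Kfin.
have id := integrable_dist mK fi (ic d).
rewrite -Rintegral_cst_len// -RintegralD//.
apply: le_Rintegral => //.
- exact: integrable_dist.
- exact: (integrableD mK id (ic _)).
- by move=> x _; exact: ler_distD.
Qed.

(** The mean is within a factor 2 of the best constant, because its distance to
any c is at most the average of |f - c|. *)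
Lemma oscillation_le K f c : borel K -> (mu K < +oo)%E -> 0 < len K ->
  mu.-integrable K (EFin \o f) ->
  oscillation f K <= 2 * \int[mu]_(x in K) `|f x - c|.
Proof.
move=> mK Kfin K0 fi; have ic := @integrable_cst_finite K c mK Kfin.
apply: (le_trans (Rintegral_le_dist (mean f K) c mK Kfin fi)).
suff : `|c - mean f K| * len K <= \int[mu]_(x in K) `|f x - c| by lra.
have -> : `|c - mean f K| * len K = `|\int[mu]_(x in K) (f x - c)|.
  rewrite RintegralB// Rintegral_cst_len// -[X in _ * X = _](gtr0_norm K0).
  by rewrite -normrM distrC mulrBl /mean mulrAC mulVf ?mul1r// gt_eqF.
apply: le_normr_Rintegral => //; exact: (integrableB mK fi ic).
Qed.

Lemma Rintegral_halves K A B f : borel A -> borel B ->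
  A `&` B = set0 -> A `|` B = K -> mu.-integrable K (EFin \o f) ->
  \int[mu]_(x in K) f x = \int[mu]_(x in A) f x + \int[mu]_(x in B) f x.
Proof.
move=> mA mB AB0 <- fi; apply: Rintegral_setU => //.
exact/eqP.
Qed.

(** With a and b the integrals over A and B, the mean over either half differs
from the mean over K by |b - a| / |K|; recentring costs this times |K| / 2 on
each half. *)
Lemma oscillation_halves K A B f : borel A -> borel B ->
  A `&` B = set0 -> A `|` B = K ->
  (mu K < +oo)%E -> 0 < len K -> len A = len K / 2 -> len B = len K / 2 ->
  mu.-integrable K (EFin \o f) ->
  oscillation f K <= oscillation f A + oscillation f B
    + `|\int[mu]_(x in B) f x - \int[mu]_(x in A) f x|.
Proof.
move=> mA mB AB0 ABK Kfin K0 lA lB fi.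
have mK : borel K by rewrite -ABK; exact: measurableU.
have AK : A `<=` K by rewrite -ABK; exact: subsetUl.
have BK : B `<=` K by rewrite -ABK; exact: subsetUr.
have Afin : (mu A < +oo)%E.
  by apply: le_lt_trans Kfin; apply: le_measure; rewrite ?inE.
have Bfin : (mu B < +oo)%E.
  by apply: le_lt_trans Kfin; apply: le_measure; rewrite ?inE.
have fA := integrableS mK mA AK fi; have fB := integrableS mK mB BK fi.
have iK := integrable_cst_finite (mean f K) mK Kfin.
rewrite {1}/oscillation (Rintegral_halves mA mB AB0 ABK); last first.
  exact: integrable_dist.
have := Rintegral_le_dist (mean f K) (mean f A) mA Afin fA.
have := Rintegral_le_dist (mean f K) (mean f B) mB Bfin fB.
rewrite -/(oscillation f A) -/(oscillation f B) lA lB.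
set a := \int[mu]_(x in A) f x; set b := \int[mu]_(x in B) f x.
have mean_half J : len J = len K / 2 ->
    `|mean f J - mean f K| * (len K / 2) =
    `|\int[mu]_(x in J) f x - (a + b) / 2|.
  move=> lJ; rewrite -(@gtr0_norm _ (len K / 2)) ?divr_gt0// -normrM.
  rewrite /mean lJ (Rintegral_halves mA mB AB0 ABK fi) -/a -/b.
  by congr `| _ |; field; rewrite gt_eqF.
rewrite !mean_half// -/a -/b.
have -> : b - (a + b) / 2 = (b - a) / 2 by field.
have -> : a - (a + b) / 2 = - ((b - a) / 2) by field.
rewrite normrN normrM (@gtr0_norm _ (2^-1)) ?invr_gt0// => hB hA.
by apply: (le_trans (lerD hA hB)); rewrite addrACA -splitr.
Qed.

Lemma Rintegral_mul_indic K f : borel K -> mu.-integrable K (EFin \o f) ->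
  \int[mu]_x (f x * \1_K x) = \int[mu]_(x in K) f x
  /\ mu.-integrable [set: R] (EFin \o (fun x => f x * \1_K x)).
Proof.
move=> mK fi; have E : (fun x => f x * \1_K x) = f \_ K by rewrite patch_indic.
split; first by rewrite [RHS]Rintegral_mkcond E.
rewrite E -restrict_EFin; move/(integrable_mkcond _ mK): fi. exact.
Qed.

Lemma inner_haar D f K : dyadic_grid D -> D K ->
  mu.-integrable K (EFin \o f) ->
  inner f (haar D K) = (Num.sqrt (len K))^-1 *
    (\int[mu]_(x in right_half D K) f x - \int[mu]_(x in left_half D K) f x).
Proof.
move=> hD DK fi; have [[DA AK _] [DB BK _] _ _] := dyadic_halves hD DK.
have mK := dyadic_measurable hD DK.
have mA := dyadic_measurable hD DA; have mB := dyadic_measurable hD DB.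
have [<- iA] := Rintegral_mul_indic mA (integrableS mK mA AK fi).
have [<- iB] := Rintegral_mul_indic mB (integrableS mK mB BK fi).
rewrite -RintegralB// -RintegralZl//; last first.
  exact: (integrableB measurableT iB iA).
by apply: eq_Rintegral => x _; rewrite /haar; ring.
Qed.

End oscillation.

(** * Small intervals *)

Section approximation.
Context {R : realType}.
Implicit Types (K : set R) (f g : R -> R).
Local Notation mu := (@lebesgue_measure R).

Lemma compact_uniformly_continuous K g (e : R) : compact K -> continuous g ->
  0 < e -> exists2 d : R, 0 < d &
    forall x y, K x -> `|x - y| < d -> `|g x - g y| < e.
Proof.
move=> /compact_near_coveringP cK cg e0.
pose P d x := forall y, `|x - y| < d -> `|g x - g y| < e.
have [] := cK _ (0^'+) P _.
  move=> x Kx; have e2 : 0 < e / 2 by rewrite divr_gt0.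
  have /cvgrPdist_lt/(_ _ e2) := cg x.
  move=> /nbhs_ballP[r /= r0 rg].
  have r2 : 0 < r / 2 by rewrite divr_gt0.
  exists (ball x (r / 2), [set d | d < r / 2]) => /=.
    by split; [exact: nbhsx_ballx|exact: nbhs_right_lt].
  move=> [x' d] /= [xx' dr] y x'y.
  have gx' : `|g x - g x'| < e / 2.
    by apply: rg; apply: lt_le_trans xx' _; lra.
  have gy : `|g x - g y| < e / 2.
    apply: rg; rewrite /ball/=; apply: (le_lt_trans (ler_distD x' _ _)).
    have : `|x - x'| < r / 2 by exact: xx'.
    by have := lt_trans x'y dr; lra.
  apply: (le_lt_trans (ler_distD (g x) _ _)); rewrite (distrC (g x')).
  by rewrite [ltRHS]splitr ltrD.
move=> d /= d0 dP; exists (d / 2); first by rewrite divr_gt0.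
move=> x y Kx xy; apply: (dP (d / 2)) => //=.
- by rewrite sub0r normrN gtr0_norm ?divr_gt0//; lra.
- by rewrite divr_gt0.
Qed.

(** Density of continuous functions in L^1(K), and uniform continuity of the
approximant on a segment containing K. *)
Lemma exists_uniform_approximation K f : is_interval K -> (mu K < +oo)%E ->
  0 < len K -> mu.-integrable K (EFin \o f) ->
  exists g (d : R), [/\ 0 < d, mu.-integrable K (EFin \o g),
    \int[mu]_(x in K) `|f x - g x| <= len K &
    forall x y, K x -> K y -> `|x - y| < d -> `|g x - g y| <= 1].
Proof.
move=> iK Kfin K0 fi; have mK := is_interval_measurable iK.
have [g_ [cg gi]] := approximation_continuous_integrable mK Kfin fi.
move=> /fine_cvgP[_ /cvgrPdist_le/(_ _ K0)] [n _ /(_ n (leqnn n))] /=.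
rewrite sub0r normrN => /(le_trans (ler_norm _)) fg.
have [u Ku] : K !=set0.
  by apply/set0P/eqP => KE; rewrite KE /len measure0 ltxx in K0.
(* K lies within [len K] of its point u. *)
have [d d0 dP] := compact_uniformly_continuous
  (@segment_compact R (u - len K) (u + len K)) (cg n) (@ltr01 R).
exists (g_ n), d; split=> // x y Kx _ xy; apply/ltW/dP => //=.
rewrite in_itv/=; apply/andP; split.
  by rewrite lerBlDr -lerBlDl; exact: interval_dist_le_len.
by rewrite -lerBlDl; exact: interval_dist_le_len.
Qed.

(** On such a K, f is within |f - g| + 1 of the constant g u, for any u in K. *)
Lemma oscillation_small K f g : borel K ->
  (mu K < +oo)%E -> 0 < len K ->
  mu.-integrable K (EFin \o f) -> mu.-integrable K (EFin \o g) ->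
  (forall x y, K x -> K y -> `|g x - g y| <= 1) ->
  oscillation f K <= 2 * (\int[mu]_(x in K) `|f x - g x| + len K).
Proof.
move=> mK Kfin K0 fi gi gP.
have [u Ku] : K !=set0.
  by apply/set0P/eqP => KE; rewrite KE /len measure0 ltxx in K0.
apply: (le_trans (oscillation_le (g u) mK Kfin K0 fi)).
rewrite ler_pM2l//.
have ic (c : R) := integrable_cst_finite c mK Kfin.
have ifg := integrable_dist mK fi gi.
have -> : len K = \int[mu]_(x in K) 1 by rewrite Rintegral_cst_len ?mul1r.
rewrite -RintegralD//.
apply: le_Rintegral => //.
- exact: integrable_dist.
- exact: (integrableD mK ifg (ic 1)).
- move=> x Kx; apply: (le_trans (ler_distD (g x) _ _)).
  by rewrite lerD2l gP.
Qed.

End approximation.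

(** * The recursion over scales *)

(** The weight 1 / L is the one that makes the first terms, summed over all
dyadic intervals inside one of length L, a bounded multiple of L. *)
Lemma ler_weighted_amgm (R : realFieldType) (L l t c : R) :
  0 < L -> 0 < l -> c = (t / l) ^+ 2 ->
  `|t| <= l ^+ 2 / (2 * L) + L / 2 * c.
Proof.
move=> L0 l0 ->.
have -> : (t / l) ^+ 2 = (`|t| / l) ^+ 2.
  by rewrite !expr_div_n real_normK ?num_real.
rewrite -[leLHS](divfK (lt0r_neq0 l0)); move: (`|t| / l) => s.
rewrite -subr_ge0 (_ : _ - _ = (l - L * s) ^+ 2 / (2 * L)).
  by rewrite divr_ge0 ?sqr_ge0// mulr_ge0// ltW.
by field; rewrite gt_eqF.
Qed.

(** One step of the recursion, for an interval of length l inside one of length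
L. It closes because 2 (l / 2)^2 / L + l^2 / (2 L) = l^2 / L. *)
Lemma oscillation_step (R : realFieldType) (L l t c oA oB iA iB eA eB eK : R) :
  0 < L -> 0 < l -> c = (t / l) ^+ 2 -> eA + eB + c <= eK ->
  oA <= 2 * (iA + l / 2) + (l / 2) ^+ 2 / L + L / 2 * eA ->
  oB <= 2 * (iB + l / 2) + (l / 2) ^+ 2 / L + L / 2 * eB ->
  oA + oB + `|t| <= 2 * (iA + iB + l) + l ^+ 2 / L + L / 2 * eK.
Proof.
move=> L0 l0 cE eK' hA hB; have ht := ler_weighted_amgm L0 l0 cE.
have hE : L / 2 * (eA + eB + c) <= L / 2 * eK.
  by rewrite ler_pM2l// divr_gt0.
have -> : l ^+ 2 / L = (l / 2) ^+ 2 / L + (l / 2) ^+ 2 / L + l ^+ 2 / (2 * L).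
  by field; rewrite gt_eqF.
move: ht hA hB hE; rewrite !mulrDr.
move: (l ^+ 2 / (2 * L)) ((l / 2) ^+ 2 / L) (`|t| : R) (L / 2 * eA) (L / 2 * eB)
  (L / 2 * c) (L / 2 * eK) => p q r u v w z.
lra.
Qed.

Section H12_subset_BMO.
Context {R : realType}.
Variables (D : set (set R)) (f : R -> R).
Hypotheses (hD : dyadic_grid D) (hf : f \in Lfun (@lebesgue_measure R) 2%:E).
Implicit Types (I J K : set R).
Local Notation mu := (@lebesgue_measure R).

Lemma Lfun2_integrable_finite K : borel K ->
  (mu K < +oo)%E -> mu.-integrable K (EFin \o f).
Proof.
move=> mK Kfin.
have f2 := integrableS measurableT mK (@subsetT _ _) (Lfun2_integrable_sqr hf).
have h1 := integrableD mK (integrable_cst_finite 1 mK Kfin) f2.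
apply: (le_integrable mK _ _ h1).
  apply/measurable_EFinP; apply: measurable_funTS.
  by have := sub_Lfun_mfun hf; rewrite inE.
move=> x _; rewrite /= lee_fin.
rewrite [leRHS]ger0_norm; last by rewrite addr_ge0// sqr_ge0.
by rewrite -real_normK ?num_real//; have := normr_ge0 (f x); nra.
Qed.

Definition haar_energy K : R := (len K)^-1 * `|inner f (haar D K)| ^+ 2.

Definition local_energy K : \bar R :=
  \esum_(J in D `&` [set J | J `<=` K]) (haar_energy J)%:E.

Lemma haar_energy_ge0 K : (0 <= (haar_energy K)%:E)%E.
Proof. by rewrite lee_fin mulr_ge0 ?invr_ge0 ?fine_ge0// sqr_ge0. Qed.

(** The normalization |K|^-1/2 of the Haar function, squared, joins the weight
|K|^-1: the energy is the squared change of mean from K to either half. *)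
Lemma haar_energyE K : D K -> haar_energy K =
  ((\int[mu]_(x in right_half D K) f x - \int[mu]_(x in left_half D K) f x)
    / len K) ^+ 2.
Proof.
move=> DK; have K0 := dyadic_len_gt0 hD DK.
rewrite /haar_energy inner_haar//; last first.
  apply: Lfun2_integrable_finite; first exact: (dyadic_measurable hD).
  exact: (dyadic_mu_lty hD).
rewrite real_normK ?num_real// exprMn exprVn sqr_sqrtr ?ltW//.
by field; rewrite gt_eqF.
Qed.

(** The dyadic intervals inside one half of K, those inside the other, and K
itself form three disjoint families of dyadic intervals inside K. *)
Lemma local_energy_halves K : D K ->
  (local_energy (left_half D K) + local_energy (right_half D K)
   + (haar_energy K)%:E <= local_energy K)%E.
Proof.
move=> DK; have [cA cB AB0 _] := dyadic_halves hD DK.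
move: (left_half D K) (right_half D K) cA cB AB0 => A B cA cB AB0.
have child_ltK J : dyadic_children D K J -> ~ K `<=` J.
  move=> [DJ _ lJ] /(dyadic_subset_len hD DK DJ); rewrite lJ.
  by have := dyadic_len_gt0 hD DK; lra.
have K1 : D `&` [set K] = [set K].
  by apply/seteqP; split => [J []//|J ->].
(* All three sums and their bound become sums over D with indicator weights,
   compared term by term. *)
rewrite -(esum_set1 (a := fun J => (haar_energy J)%:E) (haar_energy_ge0 K)).
rewrite -K1 /local_energy !esum_mkcondr.
have if_ge0 (b : bool) J : (0 <= if b then (haar_energy J)%:E else 0)%E.
  by case: b => //; exact: haar_energy_ge0.
rewrite -!esumD//; last by move=> J _; rewrite adde_ge0.
apply: le_esum => J DJ.
have c0 := haar_energy_ge0 J; have [x Jx] := dyadic_neq0 hD DJ.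
have [_ AK _] := cA; have [_ BK _] := cB.
have [JA|JA] := pselect (J `<=` A).
  have JB : ~ J `<=` B.
    move=> JB; have : (A `&` B) x := conj (JA _ Jx) (JB _ Jx).
    by rewrite AB0.
  have JK : J <> K by move=> JK; apply: (child_ltK _ cA); rewrite -JK.
  rewrite (mem_set (A := [set J | J `<=` A])) //.
  rewrite (memNset (A := [set J | J `<=` B])) // (memNset (A := [set K])) //.
  rewrite (mem_set (A := [set J | J `<=` K])) ?adde0 //=.
  exact: subset_trans AK.
rewrite (memNset (A := [set J | J `<=` A])) //.
have [JB|JB] := pselect (J `<=` B).
  have JK : J <> K by move=> JK; apply: (child_ltK _ cB); rewrite -JK.
  rewrite (mem_set (A := [set J | J `<=` B])) // (memNset (A := [set K])) //.
  rewrite (mem_set (A := [set J | J `<=` K])) ?adde0 ?add0e //=.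
  exact: subset_trans BK.
rewrite (memNset (A := [set J | J `<=` B])) // !add0e.
have [->|JK] := pselect (J = K).
  rewrite (mem_set (A := [set K])) //.
  by rewrite (mem_set (A := [set J | J `<=` K])) //=.
by rewrite (memNset (A := [set K])).
Qed.

Lemma local_energy_ge0 K : (0 <= local_energy K)%E.
Proof. by apply: esum_ge0 => J _; exact: haar_energy_ge0. Qed.

(** Induction on the scale, from intervals of length below d, on which g varies
by at most 1, up to I. The length of I stays fixed as the reference scale. *)
Lemma oscillation_le_local_energy I g (d : R) : D I -> 0 < d ->
  mu.-integrable I (EFin \o g) ->
  (forall x y, I x -> I y -> `|x - y| < d -> `|g x - g y| <= 1) ->
  forall n K, D K -> K `<=` I -> (local_energy K < +oo)%E ->
  len K < d * 2 ^+ n ->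
  oscillation f K <= 2 * (\int[mu]_(x in K) `|f x - g x| + len K)
    + len K ^+ 2 / len I + len I / 2 * fine (local_energy K).
Proof.
move=> DI d0 gI gP; have L0 := dyadic_len_gt0 hD DI.
have mI := dyadic_measurable hD DI.
elim=> [|n IHn] K DK KI EK ld.
- have K0 := dyadic_len_gt0 hD DK; have mK := dyadic_measurable hD DK.
  have Kfin := dyadic_mu_lty hD DK.
  rewrite expr0 mulr1 in ld.
  have gP' x y : K x -> K y -> `|g x - g y| <= 1.
    move=> Kx Ky; apply: gP; [exact: KI|exact: KI|].
    apply: le_lt_trans ld; have iK := dyadic_interval hD DK.
    by rewrite ler_norml lerNl opprB !interval_dist_le_len.
  apply: (le_trans (oscillation_small mK Kfin K0
    (Lfun2_integrable_finite mK Kfin) (integrableS mI mK KI gI) gP')).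
  rewrite -addrA lerDl addr_ge0//.
    by rewrite divr_ge0 ?sqr_ge0// ltW.
  by rewrite mulr_ge0 ?divr_ge0 ?(ltW L0)// fine_ge0// local_energy_ge0.
- have K0 := dyadic_len_gt0 hD DK; have mK := dyadic_measurable hD DK.
  have Kfin := dyadic_mu_lty hD DK.
  have fK := Lfun2_integrable_finite mK Kfin.
  have gK := integrableS mI mK KI gI.
  have EsK := local_energy_halves DK; have cE := haar_energyE DK.
  have [[DA AK lA] [DB BK lB] AB0 ABK] := dyadic_halves hD DK.
  move: (left_half D K) (right_half D K) EsK cE DA AK lA DB BK lB AB0 ABK.
  move=> A B EsK cE DA AK lA DB BK lB AB0 ABK.
  have mA := dyadic_measurable hD DA; have mB := dyadic_measurable hD DB.
  have EA0 := local_energy_ge0 A; have EB0 := local_energy_ge0 B.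
  have EA : (local_energy A < +oo)%E.
    apply: le_lt_trans EK; apply: le_trans EsK.
    by rewrite -addeA leeDl// adde_ge0// haar_energy_ge0.
  have EB : (local_energy B < +oo)%E.
    apply: le_lt_trans EK; apply: le_trans EsK.
    by rewrite addeAC leeDr// adde_ge0// haar_energy_ge0.
  have ld' J : len J = len K / 2 -> len J < d * 2 ^+ n.
    by move=> ->; rewrite ltr_pdivrMr// -mulrA -exprSr.
  have hA := IHn A DA (subset_trans AK KI) EA (ld' _ lA).
  have hB := IHn B DB (subset_trans BK KI) EB (ld' _ lB).
  apply: (le_trans (oscillation_halves mA mB AB0 ABK Kfin K0 lA lB fK)).
  rewrite (Rintegral_halves mA mB AB0 ABK (integrable_dist mK fK gK)).
  rewrite lA in hA; rewrite lB in hB.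
  apply: (oscillation_step L0 K0 cE _ hA hB).
  rewrite -lee_fin !EFinD !fineK// ge0_fin_numE//.
  exact: local_energy_ge0.
Qed.

Lemma oscillation_le_total_energy I : D I ->
  (\esum_(J in D) (haar_energy J)%:E < +oo)%E ->
  oscillation f I <=
    len I * (5 + fine (\esum_(J in D) (haar_energy J)%:E) / 2).
Proof.
move=> DI Sfin; set S := (\esum_(J in D) _)%E.
have I0 := dyadic_len_gt0 hD DI; have Ifin := dyadic_mu_lty hD DI.
have mI := dyadic_measurable hD DI.
have [g [d [d0 gI fg gP]]] := exists_uniform_approximation
  (dyadic_interval hD DI) Ifin I0 (Lfun2_integrable_finite mI Ifin).
have leS : (local_energy I <= S)%E.
  rewrite /local_energy esum_mkcondr; apply: le_esum => J _.
  by case: ifP => // _; exact: haar_energy_ge0.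
have EI : (local_energy I < +oo)%E by exact: le_lt_trans Sfin.
have [n ln] : exists n, len I < d * 2 ^+ n.
  have := archi_boundP (ltW (divr_gt0 I0 d0)).
  rewrite ltr_pdivrMr// mulrC => In.
  exists (Num.bound (len I / d)); apply: (lt_le_trans In).
  by rewrite ler_pM2l// -natrX ler_nat ltnW// ltn_expl.
apply: (le_trans (oscillation_le_local_energy DI d0 gI gP DI
  (@subset_refl _ I) EI ln)).
have eS : fine (local_energy I) <= fine S.
  rewrite fine_le// ge0_fin_numE//; first exact: local_energy_ge0.
  exact: le_trans (local_energy_ge0 I) leS.
rewrite expr2 mulfK ?gt_eqF//.
have : len I / 2 * fine (local_energy I) <= len I / 2 * fine S.
  by rewrite ler_pM2l// divr_gt0.
by lra.
Qed.

End H12_subset_BMO.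

(** * The inclusion *)

Theorem proposition6 (R : realType) (D : set (set R)) (hD : dyadic_grid D) :
  H12 D `<=` BMO D.
Proof.
move=> f [hf Sfin]; split.
- split; first by have := sub_Lfun_mfun hf; rewrite inE.
    exact: openT.
  move=> K _ cK.
  have mK : borel K by exact: compact_measurable.
  have Kfin := compact_finite_measure cK.
  by have /integrableP[] := Lfun2_integrable_finite hf mK Kfin.
- set M := 5 + fine (\esum_(J in D) (haar_energy D f J)%:E) / 2.
  apply: (@le_lt_trans _ _ M%:E); last exact: ltry.
  apply: ge_ereal_sup => _ [I DI <-].
  have I0 := dyadic_len_gt0 hD DI; have Ifin := dyadic_mu_lty hD DI.
  have mI := dyadic_measurable hD DI.
  have fI := Lfun2_integrable_finite hf mI Ifin.
  have iI := integrable_dist mI fI (integrable_cst_finite (mean f I) mI Ifin).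
  have := oscillation_le_total_energy hD hf DI Sfin.
  rewrite -/M -ler_pdivrMl// -lee_fin EFinM /oscillation /Rintegral fineK//.
  exact: integrable_fin_num.
Qed.
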